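(* All Puchta groups are non amenable. That is, if $G$ is a group with a presentation $\langle X|R\rangle$, $X$ finite and $R$ finite or infinite, such that $\mathrm{def}_p(G;X,R)>1$ for some prime $p$, then $G$ is not amenable.
   Context: For a presentation $\langle X|R\rangle$ of $G$ with $X$ finite and $R$ a subset (finite or infinite) of the free group $F(X)$, the $p$-deficiency is $\mathrm{def}_p(G;X,R)=|X|-\sum_{r\in R}p^{-\nu_p(r)}$, where $\nu_p(r)=\max\{k\ge 0 : \exists w\in F(X),\ w^{p^k}=r\}$; if $R$ is infinite and the sum does not converge, then $\mathrm{def}_p(G;X,R)=-\infty$. A (discrete) group is amenable if it admits a finitely additive, left invariant probability measure defined on all its subsets. *)

(* Defs.v *)
From HB Require Import structures.
From mathcomp Require Import all_boot all_order all_algebra.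
From mathcomp Require Import all_classical all_reals all_analysis.

Set Implicit Arguments.
Unset Strict Implicit.
Unset Printing Implicit Defensive.

Import Order.TTheory GRing.Theory Num.Theory.

Local Open Scope classical_set_scope.

Section FreeGroup.
Variable X : choiceType.

(* The letter [(x, false)] stands for the generator [x] and [(x, true)] for
   its inverse. *)
Definition letter : Type := (X * bool)%type.

Definition letter_inv (a : letter) : letter := (a.1, ~~ a.2).

Definition reduced (s : seq letter) : bool :=
  sorted (fun a b => b != letter_inv a) s.

Definition consl (a : letter) (s : seq letter) : seq letter :=
  if s is b :: t then if b == letter_inv a then t else a :: s else [:: a].

Definition word_mul (s t : seq letter) : seq letter := foldr consl t s.

Definition word_inv (s : seq letter) : seq letter := rev (map letter_inv s).

Record free_group := FreeGroup { word : seq letter; _ : reduced word }.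

HB.instance Definition _ := [isSub for word].
HB.instance Definition _ := [Choice of free_group by <:].

Lemma letter_invK : involutive letter_inv.
Proof. by case=> x b; rewrite /letter_inv /= negbK. Qed.

Lemma letter_inv_neq a : letter_inv a != a.
Proof. by case: a => x b; rewrite xpair_eqE eqxx /=; case: b. Qed.

Lemma reduced_cons a s :
  reduced (a :: s) = (if s is b :: _ then b != letter_inv a else true)
                     && reduced s.
Proof. by case: s. Qed.

Lemma reduced_consl a s : reduced s -> reduced (consl a s).
Proof.
case: s => [//|b t] rbt; rewrite /consl; case: ifP => [_|nba].
  by move: rbt; rewrite reduced_cons => /andP[].
by rewrite reduced_cons nba.
Qed.

Lemma reduced_mul s t : reduced t -> reduced (word_mul s t).
Proof. by move=> rt; elim: s => //= a s; exact: reduced_consl. Qed.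

Lemma conslK a s : reduced s -> consl (letter_inv a) (consl a s) = s.
Proof.
case: s => [|b t]; first by rewrite /= letter_invK eqxx.
rewrite reduced_cons => /andP[+ _]; rewrite /=.
case: ifP => [/eqP -> |_] /=; last by rewrite letter_invK eqxx.
by case: t => [//|c t] /negbTE /= ->.
Qed.

Lemma consl_reduced a s : reduced (a :: s) -> consl a s = a :: s.
Proof. by rewrite reduced_cons; case: s => //= b s /andP[/negbTE ->]. Qed.

Lemma word_mulA s t u : reduced u ->
  word_mul s (word_mul t u) = word_mul (word_mul s t) u.
Proof.
move=> ru; elim: s => //= a s ->.
case: (word_mul s t) => //= b v.
case: ifP => [/eqP -> |] //=.
by have := conslK (letter_inv a) (reduced_mul v ru); rewrite letter_invK.
Qed.

Lemma word_mul0 s : reduced s -> word_mul s [::] = s.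
Proof.
elim: s => [//|a s IHs] ras; rewrite -[RHS]consl_reduced //=.
by rewrite IHs //; move: ras; rewrite reduced_cons => /andP[].
Qed.

Lemma word_mul_cat s t u : word_mul (s ++ t) u = word_mul s (word_mul t u).
Proof. by rewrite /word_mul foldr_cat. Qed.

Lemma word_invK s : word_inv (word_inv s) = s.
Proof.
by rewrite /word_inv map_rev revK -map_comp (eq_map letter_invK) map_id.
Qed.

Lemma word_mulVK s t : reduced t -> word_mul (word_inv s) (word_mul s t) = t.
Proof.
move=> rt; elim: s => //= a s IHs.
rewrite /word_inv /= rev_cons -cats1 word_mul_cat /= conslK ?IHs //.
exact: reduced_mul.
Qed.

Lemma reduced_inv s : reduced s -> reduced (word_inv s).
Proof.
rewrite /reduced /word_inv rev_sorted sorted_map => rs.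
apply: sub_sorted rs => a b /=; apply: contra => /eqP ab.
by rewrite -[b]letter_invK -ab.
Qed.

Implicit Types g h k : free_group.

Definition free_one : free_group := @FreeGroup [::] isT.
Definition free_mul g h : free_group :=
  FreeGroup (reduced_mul (word g) (valP h)).
Definition free_inv g : free_group := FreeGroup (reduced_inv (valP g)).

Lemma free_mulA : associative free_mul.
Proof. by move=> g h k; apply: val_inj => /=; rewrite word_mulA ?(valP k). Qed.
Lemma free_mul1g : left_id free_one free_mul.
Proof. by move=> g; exact: val_inj. Qed.
Lemma free_mulg1 : right_id free_one free_mul.
Proof. by move=> g; apply: val_inj; exact: word_mul0 (valP g). Qed.
Lemma free_mulVg : left_inverse free_one free_inv free_mul.
Proof.
move=> g; apply: val_inj => /=.
by rewrite -{2}(word_mul0 (valP g)) word_mulVK.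
Qed.
Lemma free_mulgV : right_inverse free_one free_inv free_mul.
Proof.
move=> g; rewrite -[X in free_mul X _](_ : free_inv (free_inv g) = g).
  exact: free_mulVg.
by apply: val_inj; exact: word_invK.
Qed.

HB.instance Definition _ := isGroup.Build free_group
  free_mulA free_mul1g free_mulg1 free_mulVg free_mulgV.

Definition free_gen (x : X) : free_group := @FreeGroup [:: (x, false)] isT.

End FreeGroup.

Local Open Scope group_scope.

Section UniversalProperty.
Variables (X : choiceType) (G : groupType) (f : X -> G).

Definition letter_eval (a : letter X) : G := if a.2 then (f a.1)^-1 else f a.1.

Definition free_lift (g : free_group X) : G :=
  foldr (fun a y => letter_eval a * y) 1 (word g).

Lemma free_lift_is_multiplicative : {morph free_lift : g h / g * h}.
Proof.
move=> [s rs] [t rt]; rewrite /free_lift /=; elim: s {rs} => [|a s IHs] /=.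
  by rewrite mul1g.
rewrite -mulgA -IHs; case: (word_mul s t) => //= b v.
case: ifP => [/eqP ->|] //=; rewrite mulgA /letter_eval /=.
by case: (a.2); rewrite /= ?mulVg ?mulgV mul1g.
Qed.

HB.instance Definition _ :=
  isMultiplicative.Build (free_group X) G free_lift free_lift_is_multiplicative.

Lemma free_lift_gen x : free_lift (free_gen x) = f x.
Proof. exact: mulg1. Qed.

Lemma free_lift_unique (phi : {multiplicative free_group X -> G}) :
  (forall x, phi (free_gen x) = f x) -> phi =1 free_lift.
Proof.
move=> phif; have phi1 : phi 1 = 1.
  by apply: (mulgI (phi 1)); rewrite -gmulfM !mulg1.
have phiV g : phi g^-1 = (phi g)^-1.
  by apply: (mulgI (phi g)); rewrite -gmulfM !mulgV.
case=> s; elim: s => [|a s IHs] rs.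
  by rewrite /free_lift /= -phi1; congr (phi _); exact: val_inj.
have rs' : reduced s by move: rs; rewrite reduced_cons => /andP[].
have -> : FreeGroup rs =
    (if a.2 then (free_gen a.1)^-1 else free_gen a.1) * FreeGroup rs'.
  apply: val_inj; rewrite /= -(consl_reduced rs).
  by case: a {rs} => x [].
rewrite gmulfM IHs free_lift_is_multiplicative; congr (_ * _).
by case: ifP => _; rewrite ?phiV phif /free_lift /letter_eval /= mulg1.
Qed.

End UniversalProperty.

Definition normal_subgroup (G : groupType) (N : set G) : Prop :=
  [/\ N 1, forall x y, N x -> N y -> N (x * y^-1)
    & forall x y, N x -> N (x ^ y)].

Definition normal_closure (G : groupType) (R : set G) : set G :=
  smallest (@normal_subgroup G) R.

(* [G] has the presentation <X|R>: it is the quotient of [F(X)] by the normal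
   closure of [R], up to isomorphism. *)
Definition has_presentation (X : finType) (R : set (free_group X))
    (G : groupType) : Prop :=
  exists phi : {multiplicative free_group X -> G},
    (forall g, exists w, phi w = g) /\
    (forall w, phi w = 1 <-> normal_closure R w).

Definition root_exponents (p : nat) (X : choiceType) (r : free_group X) :
    set nat :=
  [set k | exists w : free_group X, w ^+ (p ^ k)%N = r].

(* [None] when there is no maximum, i.e. for [r = 1], where nu_p(r) is
   infinite. *)
Definition nu (p : nat) (X : choiceType) (r : free_group X) : option nat :=
  xget None [set Some k | k in
    [set k | root_exponents p r k /\
             forall j, root_exponents p r j -> (j <= k)%N]].

(* p^(- nu_p(r)), with p^(- oo) = 0. *)
Definition p_weight (K : realType) (p : nat) (X : choiceType)
    (r : free_group X) : K :=
  if nu p r is Some k then (p%:R ^- k)%R else 0%R.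

(* The sum of nonnegative terms [esum] is [+oo] when it diverges, so that the
   deficiency is then [-oo]. *)
Definition p_deficiency (K : realType) (p : nat) (X : finType)
    (R : set (free_group X)) : \bar K :=
  ((#|X|%:R)%:E - (\esum_(r in R) (p_weight K p r)%:E)%R)%E.

Definition Puchta_group (K : realType) (G : groupType) : Prop :=
  exists (p : nat) (X : finType) (R : set (free_group X)),
    [/\ prime p, has_presentation R G & (1 < p_deficiency K p R)%E].

Definition amenable (K : realType) (G : groupType) : Prop :=
  exists mu : set G -> K,
    [/\ forall A, (0 <= mu A)%R,
        mu setT = 1%R,
        forall A B, A `&` B = set0 -> mu (A `|` B) = (mu A + mu B)%R
      & forall (g : G) A, mu [set g * x | x in A] = mu A].

(* Main.v *)
Require Import Defs.
From HB Require Import structures.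
From mathcomp Require Import all_boot all_order all_algebra finmap zify lra.
From mathcomp Require Import all_classical all_reals all_analysis.

(* Fix the prime p and work with chains of the Cayley graph of G over F_p.
   Every 1-cycle is a combination of the chains of the loops g.r, for g in G and
   r in R.  If F is a finite set almost invariant under right multiplication by
   the generators, the 1-cycles supported on edges starting in F form a space U
   of dimension at least about |F| (|X| - 1).  Since U is finite dimensional it
   only involves finitely many loops h.r.  Let now A be a finite set much more
   invariant than F.  The translates gU, g in A, lie in the span V of the loops
   gh.r, and as each edge is met by at most |F| of them,
   |A| dim U <= |F| dim V.  If r = w^(p^j), the loops starting at g and at g w
   have the same chain, so each r contributes at most about |A| p^(-j) to
   dim V.  Hence |X| - 1 <= \sum_r p^(-nu_p(r)) up to an arbitrarily small
   error.

   Almost invariant sets exist because otherwise some finite set S satisfies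
   |S B| >= 2 |B| for every finite B; by the marriage theorem there is then an
   injection G x {0,1} -> G moving points by elements of S only, which is
   incompatible with an invariant mean. *)

Set Implicit Arguments.
Unset Strict Implicit.
Unset Printing Implicit Defensive.

Import Order.TTheory GRing.Theory Num.Theory.

(** * Hall's marriage theorem for infinite families of finite sets *)

Section Marriage.
Local Open Scope fset_scope.

Lemma chain_contains_seq (T : eqType) (F : set (set T)) (s : seq T) :
    (exists X, F X) -> total_on F subset ->
    (forall t, t \in s -> (\bigcup_(X in F) X)%classic t) ->
  exists2 X, F X & forall t, t \in s -> X t.
Proof.
move=> F0 Ftot; elim: s => [|t s IHs] sF; first by case: F0 => X FX; exists X.
have [|X FX sX] := IHs; first by move=> u us; apply: sF; rewrite inE us orbT.
have [Y FY Yt] := sF t (mem_head _ _).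
have [XY|YX] := Ftot X Y FX FY.
  by exists Y => // u; rewrite inE => /predU1P[->|/sX/XY].
by exists X => // u; rewrite inE => /predU1P[->|/sX] //; exact: YX.
Qed.

Variables (I Y : choiceType) (N : I -> {fset Y}).

(** Here [D] is a set of deleted edges in the bipartite graph joining each [i] to the elements of
    [N i]. *)
Definition remaining (D : set (I * Y)) (i : I) : {fset Y} :=
  [fset y in N i | `[< ~ D (i, y) >]].

Definition neighbours (D : set (I * Y)) (K : {fset I}) : {fset Y} :=
  \bigcup_(i <- K) remaining D i.

Definition hall_condition (D : set (I * Y)) : Prop :=
  forall K : {fset I}, (#|` K| <= #|` neighbours D K|)%N.

Lemma in_remaining D i y :
  (y \in remaining D i) = (y \in N i) && `[< ~ D (i, y) >].
Proof. by rewrite !inE. Qed.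

Lemma neighboursP D K y :
  reflect (exists2 i, i \in K & y \in remaining D i) (y \in neighbours D K).
Proof.
apply: (iffP (bigfcupP _ _ _ _)) => -[i iK yi]; exists i => //.
  by move: iK; rewrite andbT.
by rewrite iK.
Qed.

(** Compactness: only finitely many edges leave [K], so a single member of the chain already deletes
    all those that the union deletes. This feeds Zorn's lemma. *)
Lemma hall_condition_chain (F : set (set (I * Y))) :
    hall_condition set0 -> (F `<=` hall_condition)%classic ->
    total_on F subset -> hall_condition (\bigcup_(X in F) X)%classic.
Proof.
move=> hall0 Fhall Ftot K.
have [F0|F0] := pselect (exists X, F X); last first.
  suff -> : (\bigcup_(X in F) X)%classic = set0 by exact: hall0.
  by rewrite -subset0 => t [X FX]; case: F0; exists X.
set D := (\bigcup_(X in F) X)%classic.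
pose s := [seq t <- [seq (i, y) | i <- K, y <- N i] | `[< D t >]].
have [|X FX sX] := @chain_contains_seq _ F s F0 Ftot.
  by move=> t; rewrite mem_filter => /andP[/asboolP].
apply: (leq_trans (Fhall X FX K)); apply: fsubset_leq_card.
apply/fsubsetP => y /neighboursP[i iK].
rewrite in_remaining => /andP[yN /asboolP nX]; apply/neighboursP; exists i => //.
rewrite in_remaining yN; apply/asboolP => Dy; apply: nX; apply: sX.
by rewrite mem_filter; apply/andP; split; [exact/asboolP|exact: allpairs_f_dep].
Qed.

Lemma hall_condition_critical (M : set (I * Y)) i a :
    hall_condition M -> (forall B, (M `<` B)%classic -> ~ hall_condition B) ->
    a \in remaining M i ->
  exists2 L : {fset I}, i \notin L &
    (#|` neighbours M L `|` (remaining M i `\ a)| <= #|` L|)%N.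
Proof.
move=> Mhall Mmax; rewrite in_remaining => /andP[aN /asboolP aM].
have : ~ hall_condition (M `|` [set (i, a)])%classic.
  apply: Mmax; split; first by move=> t; left.
  by move=> /(_ (i, a)) Ma; apply: aM; apply: Ma; right.
move=> /existsNP[K /negP]; rewrite -ltnNge => Klt.
have remK j y : y \in remaining M j -> (j, y) <> (i, a) ->
    y \in remaining (M `|` [set (i, a)])%classic j.
  rewrite !in_remaining => /andP[-> /asboolP yM] ne.
  by apply/asboolP => -[].
have iK : i \in K.
  apply: contraTT Klt => iK; rewrite -leqNgt; apply: (leq_trans (Mhall K)).
  apply/fsubset_leq_card/fsubsetP => y /neighboursP[j jK yj].
  apply/neighboursP; exists j => //; apply: remK => // -[ji _].
  by move: iK; rewrite -ji jK.
exists (K `\ i); first by rewrite !inE eqxx.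
have := cardfsD1 i K; rewrite iK add1n => Kc.
rewrite -ltnS -Kc; apply: leq_ltn_trans Klt; apply: fsubset_leq_card.
apply/fsubsetP => y; rewrite inE => /orP[/neighboursP[j]|].
  rewrite in_fsetD1 => /andP[/eqP ji jK] yj; apply/neighboursP; exists j => //.
  by apply: (remK _ _ yj) => -[].
rewrite in_fsetD1 => /andP[/eqP ya yi]; apply/neighboursP; exists i => //.
by apply: (remK _ _ yi) => -[].
Qed.

(* Rado's argument: in a maximal deletion of edges preserving Hall's condition
   every vertex keeps exactly one edge, by submodularity of the number of
   neighbours. *)
Theorem marriage :
    (forall K : {fset I}, (#|` K| <= #|` \bigcup_(i <- K) N i|)%N) ->
  exists2 f : I -> Y, injective f & forall i, f i \in N i.
Proof.
move=> hallN.
have hall0 : hall_condition set0.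
  move=> K; rewrite /neighbours (eq_bigr N) // => i _; apply/fsetP => y.
  by rewrite in_remaining; case: (y \in N i) => //=; apply/asboolP.
have [M [Mhall Mmax]] := @Zorn_bigcup _ hall_condition
  (fun F Fh => hall_condition_chain hall0 Fh).
have uniqM i a b : a \in remaining M i -> b \in remaining M i -> a = b.
  move=> ai bi; apply/eqP; apply: contraT => ab.
  have [L1 iL1] := hall_condition_critical Mhall Mmax ai.
  have [L2 iL2] := hall_condition_critical Mhall Mmax bi.
  set P2 := _ `|` _ => c2; set P1 := _ `|` _ => c1.
  (* As [a] and [b] differ, every remaining neighbour of [i] lies in [P1] or [P2]. Adding [cU] and
     [cI] gives |L1| + |L2| + 1 <= |P1| + |P2|, against [c1] and [c2]. *)
  have cU : (#|` i |` (L1 `|` L2)| <= #|` P1 `|` P2|)%N.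
    apply: leq_trans (Mhall _) _; apply/fsubset_leq_card/fsubsetP => y.
    move=> /neighboursP[j]; rewrite /P1 /P2 !in_fsetU in_fset1 !in_fsetD1.
    move=> /or3P[/eqP-> yj|jL yj|jL yj].
    - rewrite !yj !andbT.
      by have [->|_] := eqVneq y a; rewrite ?ab ?orbT.
    - by apply/orP; left; apply/orP; left; apply/neighboursP; exists j.
    - by apply/orP; right; apply/orP; left; apply/neighboursP; exists j.
  have cI : (#|` L1 `&` L2| <= #|` P1 `&` P2|)%N.
    apply: leq_trans (Mhall _) _; apply/fsubset_leq_card/fsubsetP => y.
    move=> /neighboursP[j]; rewrite in_fsetI => /andP[j1 j2] yj.
    by rewrite in_fsetI /P1 /P2 !in_fsetU; apply/andP; split; apply/orP; left;
      apply/neighboursP; exists j.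
  have := cardfsUI P1 P2; have := cardfsUI L1 L2.
  move: cU; rewrite cardfsU1 in_fsetU negb_or iL1 iL2 /= => cU.
  by lia.
have exM i : exists y, y \in remaining M i.
  have := Mhall [fset i]; rewrite cardfs1 cardfs_gt0 => /fset0Pn[y].
  by move=> /neighboursP[j]; rewrite inE => /eqP-> yi; exists y.
have [f fP] := choice exM.
exists f => [i j fij|i]; last by have := fP i; rewrite in_remaining => /andP[].
apply/eqP; apply: contraT => ij.
have := Mhall [fset i; j]; rewrite cardfs2 ij.
suff /fsubset_leq_card : neighbours M [fset i; j] `<=` [fset f i].
  by rewrite cardfs1; case: #|` _| => [|[|]].
apply/fsubsetP => y /neighboursP[k]; rewrite in_fset2 in_fset1 => /orP[]/eqP-> yk.
  by apply/eqP; apply: uniqM yk _.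
by rewrite fij; apply/eqP; apply: uniqM yk _.
Qed.

End Marriage.

(** * Følner sets from an invariant mean *)

Section Folner.
Local Open Scope group_scope.
Variables (K : realType) (G : groupType).

Definition fset_mul (A B : {fset G}) : {fset G} :=
  [fset x * y | x in A, y in B]%fset.

Definition fset_inv (A : {fset G}) : {fset G} := [fset x^-1 | x in A]%fset.

Lemma fset_mulP (A B : {fset G}) z :
  reflect (exists x y, [/\ x \in A, y \in B & z = x * y]) (z \in fset_mul A B).
Proof.
apply: (iffP idP) => [/imfset2P[x xA [y yB ->]]|[x [y [xA yB ->]]]].
  by exists x, y.
exact: in_imfset2.
Qed.

Lemma mem_fset_mul (A B : {fset G}) x y :
  x \in A -> y \in B -> x * y \in fset_mul A B.
Proof. by move=> xA yB; apply/fset_mulP; exists x, y. Qed.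

Lemma fset_mulA (A B C : {fset G}) :
  fset_mul A (fset_mul B C) = fset_mul (fset_mul A B) C.
Proof.
apply/fsetP => z; apply/fset_mulP/fset_mulP.
  move=> [x [_ [xA /fset_mulP[y [w [yB wC ->]]] ->]]].
  by exists (x * y), w; rewrite mulgA mem_fset_mul.
move=> [_ [w [/fset_mulP[x [y [xA yB ->]]] wC ->]]].
by exists x, (y * w); rewrite mulgA mem_fset_mul.
Qed.

Lemma mem_fset_inv (A : {fset G}) x : (x \in fset_inv A) = (x^-1 \in A).
Proof.
apply/imfsetP/idP => [[y yA ->]|xA]; first by rewrite invgK.
by exists x^-1 => //; rewrite invgK.
Qed.

Lemma fset_invK : involutive fset_inv.
Proof. by move=> A; apply/fsetP => x; rewrite !mem_fset_inv invgK. Qed.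

Lemma card_fset_inv (A : {fset G}) : #|` fset_inv A| = #|` A|.
Proof. by rewrite card_imfset //; exact: invg_inj. Qed.

Lemma fset_invM (A B : {fset G}) :
  fset_inv (fset_mul A B) = fset_mul (fset_inv B) (fset_inv A).
Proof.
apply/fsetP => z; rewrite mem_fset_inv; apply/fset_mulP/fset_mulP.
  move=> [x [y [xA yB zE]]]; exists y^-1, x^-1; rewrite !mem_fset_inv !invgK.
  by split => //; rewrite -invgM -zE invgK.
move=> [y [x [yB xA ->]]]; exists x^-1, y^-1; rewrite -!mem_fset_inv.
by rewrite invgM.
Qed.

Section Mean.
Variable mu : set G -> K.
Hypothesis mu_ge0 : forall A, (0 <= mu A)%R.
Hypothesis mu1 : mu setT = 1%R.
Hypothesis muU : forall A B, (A `&` B = set0)%classic ->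
  mu (A `|` B)%classic = (mu A + mu B)%R.
Hypothesis mu_left : forall (g : G) A, mu [set g * x | x in A]%classic = mu A.

Lemma mean_le1 A : (mu A <= 1)%R.
Proof.
by rewrite -mu1 -(setUv A) muU ?setICr // lerDl.
Qed.

Lemma mean_bigcup (T : choiceType) (s : seq T) (B : T -> set G) :
    uniq s -> (forall i j x, B i x -> B j x -> i = j) ->
  mu (\bigcup_(i in [set` s]) B i)%classic = (\sum_(i <- s) mu (B i))%R.
Proof.
move=> + dB; rewrite bigcup_seq; elim: s => [_|i s IHs] /=.
  rewrite !big_nil; apply: (@addrI _ (mu set0)).
  by rewrite -muU ?setI0 // setU0 addr0.
case/andP=> is_ us; rewrite !big_cons muU ?IHs //.
rewrite -subset0 -bigcup_seq => x [Bi [j js Bj]].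
by move: is_; rewrite (dB _ _ _ Bi Bj) js.
Qed.

Lemma no_doubling (S : {fset G}) :
  ~ (forall A : {fset G}, (2 * #|` A| <= #|` fset_mul S A|)%N).
Proof.
move=> dbl.
have [|f finj fN] :=
    @marriage (G * bool)%type G (fun u => fset_mul S [fset u.1]%fset).
  move=> L; set A := [fset u.1 | u in L]%fset.
  have LA : (#|` L| <= 2 * #|` A|)%N.
    pose Ab (b : bool) := [fset (x, b) | x in A]%fset.
    have cAb b : #|` Ab b| = #|` A| by rewrite card_imfset // => x y [].
    apply: (@leq_trans #|` Ab true `|` Ab false|%fset).
      apply/fsubset_leq_card/fsubsetP => -[x b] xL.
      have xA : x \in A by apply/imfsetP; exists (x, b).
      by case: b {xL}; rewrite in_fsetU !in_imfset ?orbT.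
    by rewrite cardfsU !cAb addnn -mul2n leq_subr.
  apply: (leq_trans LA); apply: (leq_trans (dbl A)).
  apply/fsubset_leq_card/fsubsetP => y /fset_mulP[s [x [sS xA ->]]].
  case/imfsetP: xA => u uL ->; apply/bigfcupP; exists u; rewrite ?uL //.
  by apply: mem_fset_mul; rewrite ?inE.
(* Pieces of a paradoxical decomposition: [f (_, b)] acts on [B b s] as left multiplication by [s],
   with image [C b s], so [U b] is the image of G x {b}. *)
pose B b s : set G := [set g | f (g, b) = s * g]%classic.
pose C b s : set G := [set s * x | x in B b s]%classic.
pose U b : set G := (\bigcup_(s in [set` (S : seq G)]) C b s)%classic.
(* The [C b s] are disjoint by injectivity of [f] and are left translates of the [B b s], which
   partition [G]. *)
have muUb b : mu (U b) = 1%R.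
  rewrite mean_bigcup ?fset_uniq; last first.
  - move=> s t _ [x xB <-] [y yB yx].
    have /finj[xy] : f (x, b) = f (y, b) by rewrite xB yB yx.
    by move: yx; rewrite xy => /mulIg.
  - by [].
  under eq_bigr do rewrite mu_left.
  rewrite -mean_bigcup ?fset_uniq //; last first.
    by move=> s t x; rewrite /B /= => -> /mulIg.
  rewrite -mu1; congr mu; apply/seteqP; split=> // g _.
  have /fset_mulP[s [x [sS]]] := fN (g, b).
  by rewrite inE => /eqP-> fE; exists s.
have := mean_le1 (U true `|` U false)%classic; rewrite muU; last first.
  rewrite -subset0 => y [[s _ [x xB <-]] [t _ [z zB zx]]].
  by have /finj : f (x, true) = f (z, false) by rewrite xB zB zx.
by rewrite !muUb; lra.
Qed.

End Mean.

Lemma bernoulli_ge (e : K) n : (0 <= e -> 1 + n%:R * e <= (1 + e) ^+ n)%R.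
Proof.
move=> e0; elim: n => [|n IHn]; first by rewrite mul0r addr0 expr0.
rewrite exprS -natr1; have : (0 <= n%:R * e)%R by rewrite mulr_ge0.
by nra.
Qed.

(** Otherwise right multiplication by [T] always enlarges a finite set by the factor 1 + e, and
    iterating it doubles every finite set. *)
Theorem folner (T : {fset G}) (e : K) : amenable K G -> (0 < e)%R ->
  exists2 A : {fset G}, A != fset0%fset &
    (#|` fset_mul A T|%:R <= (1 + e) * #|` A|%:R)%R.
Proof.
move=> [mu [mu_ge0 mu1 muU mu_left]] e0; apply: contrapT => noF.
have grow (A : {fset G}) : ((1 + e) * #|` A|%:R <= #|` fset_mul A T|%:R :> K)%R.
  have [->|A0] := eqVneq A fset0%fset; first by rewrite cardfs0 mulr0.
  by rewrite leNgt; apply/negP => lt; apply: noF; exists A => //; exact: ltW.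
pose S n := iter n (fun B => fset_mul B T) [fset 1]%fset.
have growS n (A : {fset G}) : ((1 + e) ^+ n * #|` A|%:R <= #|` fset_mul A (S n)|%:R :> K)%R.
  elim: n => [|n IHn].
    rewrite expr0 mul1r ler_nat; apply/fsubset_leq_card/fsubsetP => x xA.
    by rewrite -[x]mulg1 mem_fset_mul //= inE.
  rewrite /= fset_mulA; apply: le_trans (grow _).
  by rewrite exprS -mulrA ler_wpM2l // addr_ge0 // ltW.
(* Since n > 1/e, Bernoulli's inequality gives (1 + e)^n >= 2. *)
pose n := Num.bound (e^-1)%R.
have n2 : (2 <= (1 + e) ^+ n)%R.
  apply: le_trans (bernoulli_ge n (ltW e0)).
  have : (e^-1 < n%:R)%R by rewrite archi_boundP // invr_ge0 ltW.
  move=> /ltW; rewrite -(ler_pM2r e0) mulVf ?gt_eqF //; lra.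
(* The mean is left invariant while the growth is on the right; inversion exchanges the two
   sides. *)
apply: (@no_doubling mu _ _ _ _ (fset_inv (S n))) => // A.
rewrite -[in X in (_ <= X)%N](fset_invK A) -fset_invM card_fset_inv.
rewrite -(card_fset_inv A) -(ler_nat K) natrM.
by apply: le_trans (growS n _); rewrite ler_wpM2r.
Qed.

End Folner.

(** * Counting dimensions by linear functionals *)

Section DimensionCount.
Local Open Scope ring_scope.
Variables (k : fieldType) (vT : vectType k).

Lemma dim_le_cap_lker (f : 'Hom(vT, k^o)) (U : {vspace vT}) :
  (\dim U <= \dim (U :&: lker f) + ~~ (U <= lker f)%VS)%N.
Proof.
have [/capv_idPl -> |_] := boolP (U <= lker f)%VS; first by rewrite addn0.
rewrite -(limg_ker_dim f U) leq_add2l.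
by apply: leq_trans (dimvS (subvf _)) _; rewrite dimvf.
Qed.

(** Restrict all spaces to the kernels of the functionals, one after another. A functional that is
    nonzero on [V] lowers [\dim V] by at least one, and lowers at most [n] of the [\dim (U j)], each
    by at most one. The functionals separate the points of [V], so nothing is left at the end. *)
Lemma sum_dim_le (J : eqType) (s : seq J) (n : nat)
    (fs : seq 'Hom(vT, k^o)) (U : J -> {vspace vT}) (V : {vspace vT}) :
    (forall j, j \in s -> (U j <= V)%VS) ->
    (forall v, v \in V -> (forall f, f \in fs -> f v = 0) -> v = 0) ->
    (forall f, f \in fs -> (count (fun j => ~~ (U j <= lker f)%VS) s <= n)%N) ->
  (\sum_(j <- s) \dim (U j) <= n * \dim V)%N.
Proof.
elim: fs U V => [|f fs IHfs] U V UV V0 Un.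
  rewrite big_seq big1 // => j js; apply/eqP; rewrite dimv_eq0 -subv0.
  apply: subv_trans (UV j js) _; apply/subvP => v vV.
  by rewrite (V0 v vV) ?mem0v.
have [Vf|Vf] := boolP (V <= lker f)%VS.
  apply: IHfs => // [v vV v0|g gfs]; last by apply: Un; rewrite inE gfs orbT.
  apply: V0 => // g; rewrite inE => /predU1P[->|/v0//].
  by apply/eqP; rewrite -memv_ker; exact: (subvP Vf).
have dV : (\dim (V :&: lker f) < \dim V)%N.
  rewrite ltn_neqAle dimvS ?capvSl // andbT.
  apply: contra Vf => /eqP dV; apply/capv_idPl/eqP.
  by rewrite eqEdim capvSl dV leqnn.
have IH : (\sum_(j <- s) \dim (U j :&: lker f) <= n * \dim (V :&: lker f))%N.
  apply: IHfs => [j js|v|g gfs].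
  - by apply: capvS; [exact: UV|exact: subvv].
  - rewrite memv_cap memv_ker => /andP[vV /eqP vf] v0; apply: V0 => // g.
    by rewrite inE => /predU1P[->|/v0].
  - apply: leq_trans (Un g _); last by rewrite inE gfs orbT.
    apply: sub_count => j; apply: contra; apply: subv_trans; exact: capvSl.
apply: (@leq_trans (\sum_(j <- s) (\dim (U j :&: lker f) +
                                   ~~ (U j <= lker f)%VS))%N).
  by apply: leq_sum => j _; exact: dim_le_cap_lker.
rewrite big_split /=.
have -> : (\sum_(j <- s) ~~ (U j <= lker f)%VS)%N =
    count (fun j => ~~ (U j <= lker f)%VS) s.
  by rewrite -sum1_count [RHS]big_mkcond; apply: eq_bigr => j _; case: ifP.
apply: leq_trans (leq_add IH (Un f (mem_head _ _))) _.
by rewrite -mulnSr leq_mul2l dV orbT.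
Qed.

End DimensionCount.

(** * Elementary properties of group homomorphisms *)

Section MultiplicativeMaps.
Local Open Scope group_scope.
Variables (G H : groupType) (f : {multiplicative G -> H}).

Lemma multiplicative1 : f 1 = 1.
Proof. by apply: (mulgI (f 1)); rewrite -gmulfM !mulg1. Qed.

Lemma multiplicativeV : {morph f : x / x^-1}.
Proof.
by move=> x; apply: (mulgI (f x)); rewrite -gmulfM !mulgV multiplicative1.
Qed.

Lemma multiplicativeX n : {morph f : x / x ^+ n}.
Proof.
by move=> x; elim: n => [|n IHn]; rewrite ?multiplicative1 // !expgS gmulfM IHn.
Qed.

End MultiplicativeMaps.

(** * Chains of paths in the Cayley graph, and cycles as combinations of relator loops *)

Section Chains.
Local Open Scope group_scope.
Variables (k : fieldType) (X : finType) (G : groupType).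
Variable phi : {multiplicative free_group X -> G}.

Let gen (x : X) : G := phi (free_gen x).
Let lev := letter_eval gen.

Lemma letter_eval_inv (a : letter X) : lev (letter_inv a) = (lev a)^-1.
Proof. by case: a => x []; rewrite /lev /letter_eval //= invgK. Qed.

(* The edge (g, x) of the Cayley graph runs from g to g * gen x. *)
Definition edge (g : G) (a : letter X) (e : G * X) : k :=
  (if a.2 then - (e == (g * (gen a.1)^-1, a.1)%g)%:R
   else (e == (g, a.1))%:R)%R.

Fixpoint walk (g : G) (s : seq (letter X)) (e : G * X) : k :=
  (if s is a :: t then edge g a e + walk (g * lev a)%g t e else 0)%R.

(** These are the coefficients of the Fox derivatives of [w], mapped to the group ring of [G] and
    translated by [g]; [chainM] is the product rule of Fox calculus. *)
Definition chain (g : G) (w : free_group X) : G * X -> k := walk g (word w).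

Definition walk_end (s : seq (letter X)) : G := foldr (fun a y => lev a * y) 1 s.

Lemma walk_endE w : phi w = walk_end (word w).
Proof. exact: free_lift_unique. Qed.

Lemma edge_inv g a e : (edge g a e + edge (g * lev a)%g (letter_inv a) e = 0)%R.
Proof.
case: a => x []; rewrite /edge /lev /letter_eval /= ?mulgK ?addNr //.
by rewrite subrr.
Qed.

(** Free reduction removes only backtracking, whose two edges cancel by [edge_inv]. *)
Lemma walk_consl g a s e :
  walk g (consl a s) e = (edge g a e + walk (g * lev a)%g s e)%R.
Proof.
case: s => [|b t] //=; case: ifP => [/eqP ->|//].
by rewrite addrA edge_inv add0r letter_eval_inv mulgK.
Qed.

Lemma chainM g u v e : chain g (u * v) e = (chain g u e + chain (g * phi u)%g v e)%R.
Proof.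
rewrite walk_endE /chain /=; elim: (word u) g => [|a s IHs] g /=.
  by rewrite add0r mulg1.
by rewrite walk_consl IHs addrA mulgA.
Qed.

Lemma chain_gen g x e : chain g (free_gen x) e = (e == (g, x))%:R%R.
Proof. by rewrite /chain /= addr0. Qed.

Lemma chainV g u e : chain g u^-1 e = (- chain (g * (phi u)^-1)%g u e)%R.
Proof.
apply/eqP; rewrite -addr_eq0 -multiplicativeV; apply/eqP.
by rewrite -chainM mulVg.
Qed.

Lemma chainX g u n e :
  chain g (u ^+ n) e = (\sum_(i < n) chain (g * phi u ^+ i)%g u e)%R.
Proof.
elim: n => [|n IHn]; first by rewrite big_ord0 expg0.
by rewrite expgSr chainM IHn big_ord_recr multiplicativeX.
Qed.

Lemma chain_translate h g u y x : chain (h * g) u (h * y, x) = chain g u (y, x).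
Proof.
rewrite /chain; elim: (word u) g => //= a s IHs g; rewrite -mulgA IHs.
congr (_ + _)%R; rewrite /edge !xpair_eqE -mulgA.
by rewrite !(inj_eq (mulgI h)).
Qed.

(** The path of [w ^+ j] is already closed, so the longer path runs around it [p] times and its
    chain is a multiple of p = 0. *)
Lemma chain_root (p j : nat) g w e : p \in [pchar k]%R ->
  phi (w ^+ j) = 1 -> chain g (w ^+ (j * p)%N) e = 0%R.
Proof.
move=> pk wj; rewrite expgnA chainX wj.
rewrite (eq_bigr (fun=> chain g (w ^+ j) e)) => [|i _].
  by rewrite big_const_ord iter_addr_0 -mulr_natr pcharf0 // mulr0.
by rewrite expg1n mulg1.
Qed.

(** Expand the chain of [w ^+ (i + n)] in both orders; the loop of [w ^+ n] does not change the
    starting point of what follows. *)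
Lemma chain_shift (n i : nat) g w e : phi (w ^+ n) = 1 ->
  chain (g * phi w ^+ i) (w ^+ n) e = chain g (w ^+ n) e.
Proof.
move=> wn; apply: (@addrI _ (chain g (w ^+ i) e)).
by rewrite -multiplicativeX -chainM -expgnDr addnC expgnDr chainM wn mulg1 addrC.
Qed.

(** A list entry consists of a coefficient, a base point and a relator. *)
Definition relator_span (R : set (free_group X)) (c : G * X -> k) : Prop :=
  exists2 s : seq (k * (G * free_group X)), (forall t, t \in s -> R t.2.2) &
    forall e, c e = (\sum_(t <- s) t.1 * chain t.2.1 t.2.2 e)%R.

Section RelatorSpan.
Variable R : set (free_group X).
Local Open Scope ring_scope.

Lemma relator_span0 c : (forall e, c e = 0) -> relator_span R c.
Proof. by move=> c0; exists [::] => // e; rewrite big_nil. Qed.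

Lemma relator_spanD c d f : relator_span R c -> relator_span R d ->
  (forall e, f e = c e + d e) -> relator_span R f.
Proof.
move=> [s sR sc] [t tR td] fE; exists (s ++ t) => [u|e].
  by rewrite mem_cat => /orP[/sR|/tR].
by rewrite big_cat fE sc td.
Qed.

Lemma relator_spanZ a c d : relator_span R c ->
  (forall e, d e = a * c e) -> relator_span R d.
Proof.
move=> [s sR sc] dE; exists [seq (a * t.1, t.2) | t <- s] => [u|e].
  by case/mapP=> t /sR tR ->.
by rewrite dE sc big_map mulr_sumr; apply: eq_bigr => t _; rewrite mulrA.
Qed.

Lemma relator_span_sum (I : Type) (s : seq I) (c : I -> G * X -> k) f :
  (forall i, relator_span R (c i)) ->
  (forall e, f e = \sum_(i <- s) c i e) -> relator_span R f.
Proof.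
move=> cR; elim: s f => [|i s IHs] f fE.
  by apply: relator_span0 => e; rewrite fE big_nil.
apply: (@relator_spanD (c i) (fun e => \sum_(j <- s) c j e)) => //.
  exact: IHs.
by move=> e; rewrite fE big_cons.
Qed.

Lemma chain_relator_span g w : (forall r, R r -> phi r = 1%g) ->
  normal_closure R w -> relator_span R (chain g w).
Proof.
move=> Rphi Rw; suff [_ +] : phi w = 1%g /\ forall g, relator_span R (chain g w).
  by apply.
move: w Rw; apply: (@smallest_sub _ _ R (fun w => phi w = 1%g /\
  forall g, relator_span R (chain g w))); last first.
  move=> r Rr; split=> [|h]; first exact: Rphi.
  exists [:: (1, (h, r))] => [t|e]; first by rewrite inE => /eqP->.
  by rewrite big_seq1 mul1r.
split.
- by split=> [|h]; [exact: multiplicative1 | apply: relator_span0].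
- move=> u v [u1 uR] [v1 vR]; split; first by rewrite gmulfM multiplicativeV u1 v1 mulgV.
  move=> h; apply: (@relator_spanD (chain h u) (fun e => - 1 * chain h v e)) => //.
    by apply: relator_spanZ (vR h) _.
  by move=> e; rewrite chainM chainV u1 v1 invg1 !mulg1 mulN1r.
- move=> u v [u1 uR]; split; first by rewrite !gmulfM u1 multiplicativeV mul1g mulVg.
  move=> h; apply: (@relator_spanZ 1 _ _ (uR (h * (phi v)^-1)%g)) => e.
  by rewrite !chainM chainV multiplicativeV u1 mulg1 addrCA addNr addr0 mul1r.
Qed.

Definition boundary (c : G * X -> k) (h : G) : k :=
  \sum_(x : X) (c ((h * (gen x)^-1)%g, x) - c (h, x)).

(** Close each edge to a loop through chosen paths [H g] from 1 to [g]. Summing these loops with the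
    coefficients of [c] gives [c] itself plus path terms, in which [H h] occurs with coefficient
    minus the boundary of [c] at [h], hence 0. *)
Lemma cycle_relator_span (F F' : {fset G}) (c : G * X -> k) :
    (forall g, exists w, phi w = g) ->
    (forall w, phi w = 1%g <-> normal_closure R w) ->
    (F `<=` F')%fset -> (forall g x, g \in F -> (g * gen x)%g \in F') ->
    (forall g x, g \notin F -> c (g, x) = 0) ->
    (forall h, h \in F' -> boundary c h = 0) ->
  relator_span R c.
Proof.
move=> phi_surj phi_ker FF' FgF' cF bc.
have [s sK] := choice phi_surj.
pose H g := chain 1%g (s g).
pose loop g x := (s g * free_gen x * (s (g * gen x)%g)^-1)%g.
have loopR g x : relator_span R (chain 1%g (loop g x)).
  apply: chain_relator_span.
    by move=> r Rr; apply/phi_ker; exact: sub_gen_smallest.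
  by apply/phi_ker; rewrite /loop !gmulfM multiplicativeV !sK mulgV.
have loopE g x e : chain 1%g (loop g x) e =
    H g e + (e == (g, x))%:R - H (g * gen x)%g e.
  rewrite /loop !chainM chainV chain_gen !gmulfM !mul1g !sK.
  by rewrite mulgV.
apply: (@relator_span_sum _ F (fun g e => \sum_x c (g, x) * chain 1%g (loop g x) e)).
  move=> g; apply: (@relator_span_sum _ (index_enum X)
    (fun x e => c (g, x) * chain 1%g (loop g x) e)) => // x.
  by apply: relator_spanZ (loopR g x) _.
move=> e.
under eq_bigr => g _.
  under eq_bigr => x _ do rewrite loopE addrAC mulrDr.
  rewrite big_split /=.
  over.
rewrite big_split /= addrC.
have -> : \sum_(g <- F) \sum_x c (g, x) * (e == (g, x))%:R = c e.
  case: e => h y; have [hF|hF] := boolP (h \in F); last first.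
    rewrite cF // big_seq big1 // => g gF; rewrite big1 // => x _.
    case: eqP => [[hg _]|]; last by rewrite mulr0.
    by rewrite hg gF in hF.
  rewrite (big_fsetD1 h) //= [X in _ + X]big_seq [X in _ + X]big1 ?addr0.
    rewrite (bigD1 y) //= eqxx mulr1 big1 ?addr0 // => x xy.
    by rewrite xpair_eqE eqxx eq_sym (negbTE xy) mulr0.
  move=> g; rewrite in_fsetD1 => /andP[gh _]; rewrite big1 // => x _.
  by rewrite xpair_eqE eq_sym (negbTE gh) mulr0.
suff -> : \sum_(g <- F) \sum_x c (g, x) * (H g e - H (g * gen x)%g e) = 0.
  by rewrite addr0.
(* Summation by parts: regroup by vertices, reindexing the second term by the end [g * gen x] of the
   edge, which lies in [F']. *)
have -> : \sum_(g <- F) \sum_x c (g, x) * (H g e - H (g * gen x)%g e) =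
   - \sum_(h <- F') boundary c h * H h e.
  under eq_bigr do under eq_bigr do rewrite mulrBr.
  under [in RHS]eq_bigr do rewrite mulr_suml.
  rewrite [LHS]exchange_big [X in _ = - X]exchange_big -sumrN /=.
  apply: eq_bigr => x _.
  under [in RHS]eq_bigr do rewrite mulrBl.
  rewrite !sumrB opprB; congr (_ - _).
    by apply: big_fset_incl => // g _ gF; rewrite cF // mul0r.
  rewrite -[RHS](big_fset_incl _ (A := [fset (g * gen x)%g | g in F]%fset)) /=.
  - rewrite big_imfset /=; last by move=> g h _ _; apply: mulIg.
    by apply: eq_bigr => g _; rewrite mulgK.
  - by apply/fsubsetP => h /imfsetP[g gF ->]; exact: FgF'.
  - move=> h _ hF; rewrite cF ?mul0r //; apply: contra hF => hF.
    by apply/imfsetP; exists (h * (gen x)^-1)%g; rewrite // mulgVK.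
by rewrite big_seq big1 ?oppr0 // => h /bc ->; rewrite mul0r.
Qed.

End RelatorSpan.
End Chains.

(** * Finite-dimensional spaces of chains and the dimension estimate for cycles *)

Section FiniteChains.
Local Open Scope ring_scope.
Variables (k : fieldType) (X : finType) (G : groupType).
Variable phi : {multiplicative free_group X -> G}.

Local Notation finite_chains F := {ffun F * X -> k^o}.
Local Notation chain := (chain k phi).

Definition extend (F : {fset G}) (u : finite_chains F) (e : G * X) : k :=
  if insub e.1 is Some g then u (g, e.2) else 0.

Definition restrict (E : {fset G}) (c : G * X -> k) : finite_chains E :=
  [ffun e => c (val e.1, e.2)].

Definition translate (F E : {fset G}) (g : G) (u : finite_chains F) :
    finite_chains E :=
  restrict E (fun e => extend u (g^-1 * e.1, e.2)%g).

Definition finite_boundary (F F' : {fset G}) (u : finite_chains F) :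
    {ffun F' -> k^o} :=
  [ffun h => boundary phi (extend u) (val h)].

Definition coefficient (E : {fset G}) (e : E * X) (u : finite_chains E) : k^o :=
  u e.

Lemma extendP (F : {fset G}) a (u v : finite_chains F) e :
  extend (a *: u + v) e = a * extend u e + extend v e.
Proof.
by rewrite /extend; case: insub => [g|]; rewrite ?ffunE // mulr0 addr0.
Qed.

Lemma extend_out (F : {fset G}) (u : finite_chains F) g x :
  g \notin F -> extend u (g, x) = 0.
Proof. by move=> gF; rewrite /extend insubN. Qed.

Lemma translate_is_linear F E g : linear (@translate F E g).
Proof. by move=> a u v; apply/ffunP => e; rewrite !ffunE extendP. Qed.

HB.instance Definition _ F E g := GRing.isLinear.Build k _ _ _
  (@translate F E g) (@translate_is_linear F E g).

Lemma finite_boundary_is_linear F F' : linear (@finite_boundary F F').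
Proof.
move=> a u v; apply/ffunP => h; rewrite !ffunE /boundary scaler_sumr -big_split.
by apply: eq_bigr => x _; rewrite /= !extendP [a *: _]mulrBr opprD addrACA.
Qed.

HB.instance Definition _ F F' := GRing.isLinear.Build k _ _ _
  (@finite_boundary F F') (@finite_boundary_is_linear F F').

Lemma coefficient_is_linear E e : linear (@coefficient E e).
Proof. by move=> a u v; rewrite /coefficient !ffunE. Qed.

HB.instance Definition _ E e := GRing.isLinear.Build k _ _ _
  (@coefficient E e) (@coefficient_is_linear E e).

(** The boundary is tested on [F'] only; these are true cycles once [F'] contains both ends of every
    edge starting in [F]. *)
Definition cycles (F F' : {fset G}) : {vspace finite_chains F} :=
  lker (linfun (@finite_boundary F F')).

Lemma dim_cycles (F F' : {fset G}) :
  (#|` F| * #|X| <= \dim (cycles F F') + #|` F'|)%N.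
Proof.
have := limg_ker_dim (linfun (@finite_boundary F F')) fullv.
rewrite capfv -/(cycles F F') dimvf /dim /= muln1 card_prod -!cardfE => <-.
rewrite leq_add2l; apply: leq_trans (dimvS (subvf _)) _.
by rewrite dimvf /dim /= muln1 -cardfE.
Qed.

Lemma lker_translate (F E : {fset G}) g :
  (forall f, f \in F -> (g * f)%g \in E) ->
  lker (linfun (@translate F E g)) = 0%VS.
Proof.
move=> gF; apply/eqP; rewrite -subv0; apply/subvP => u.
rewrite memv_ker lfunE /= => /eqP u0; rewrite memv0; apply/eqP/ffunP => -[f x].
have := congr1 (fun v : finite_chains E => v ([` gF _ (valP f)]%fset, x)) u0.
by rewrite !ffunE /extend /= mulKg valK.
Qed.

(** The translate by [g] can meet an edge starting at [h] only if g^-1 h lies in [F], and g^-1 h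
    determines [g]. *)
Lemma count_translate (F E A : {fset G}) (U : {vspace finite_chains F})
    (e : E * X) :
  (count (fun g => ~~ (linfun (@translate F E g) @: U <=
                       lker (linfun (@coefficient E e)))%VS) A <= #|` F|)%N.
Proof.
rewrite -size_filter -(size_map (fun g => g^-1 * val e.1)%g).
apply: uniq_leq_size.
  rewrite map_inj_uniq ?filter_uniq ?fset_uniq //.
  by move=> g h /mulIg/invg_inj.
move=> _ /mapP[g + ->]; rewrite mem_filter => /andP[+ _].
apply: contraR => gF; apply/subvP => _ /memv_imgP[u _ ->].
by rewrite memv_ker !lfunE /= /coefficient ffunE extend_out.
Qed.

Lemma expg_gcd (z : G) m n : (z ^+ m = 1 -> z ^+ n = 1 -> z ^+ gcdn m n = 1)%g.
Proof.
move=> zm zn; have [->|m0] := posnP m; first by rewrite gcd0n.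
case: (egcdnP n m0) => a b ab _.
have : (z ^+ (a * m) = z ^+ (b * n + gcdn m n))%g by rewrite ab.
by rewrite expgnDr ![(_ * m)%N]mulnC ![(b * n)%N]mulnC !expgnA zm zn !expg1n mul1g.
Qed.

(* For r = w^(p^j), either the image z of w has order exactly p^j, and the
   translates by powers of z of the loop r have the same chain, or the order of
   z divides p^(j-1), and the chain of r is a multiple of p. *)
Lemma relator_chains_span (p j : nat) (w : free_group X) (B B' E : {fset G}) :
    p \in [pchar k] -> phi (w ^+ (p ^ j)%N)%g = 1%g ->
    (forall g i, g \in B -> (i < p ^ j)%N -> (g * phi w ^+ i)%g \in B') ->
  exists2 L : seq (finite_chains E), (size L * p ^ j <= #|` B'|)%N &
    forall g, g \in B -> restrict E (chain g (w ^+ (p ^ j)%N)%g) \in <<L>>%VS.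
Proof.
move=> pk wr BB'; have p_pr := pcharf_prime pk.
have [[j0 wj]|nwj] := pselect ((0 < j)%N /\ (phi w ^+ (p ^ j.-1)%N = 1)%g).
  exists [::] => // g _; rewrite -(prednK j0) expnSr.
  suff -> : restrict E (chain g (w ^+ (p ^ j.-1 * p)%N)%g) = 0 by exact: mem0v.
  by apply/ffunP => e; rewrite !ffunE chain_root // multiplicativeX.
have zp : (phi w ^+ (p ^ j)%N = 1)%g by rewrite -multiplicativeX.
have zinj (i i' : nat) : (i < p ^ j)%N -> (i' < p ^ j)%N ->
    (phi w ^+ i = phi w ^+ i')%g -> i = i'.
  wlog ii' : i i' / (i <= i')%N.
    move=> th ij ij' zz; have [le|/ltnW le] := leqP i i'; first exact: th.
    by apply/esym; apply: th.
  move=> _ i'j zz; apply/eqP; rewrite eqn_leq ii' /= leqNgt; apply/negP => lt.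
  have z1 : (phi w ^+ (i' - i) = 1)%g by rewrite expgnFr // zz mulgV.
  (* A coincidence of powers makes z = [phi w] killed by gcd(i' - i, p^j) = p^l. As 0 < i' - i <
     p^j, l < j, contrary to [nwj]. *)
  have /(dvdn_pfactor _ _ p_pr)[l lj gl] := dvdn_gcdr (i' - i) (p ^ j).
  have := expg_gcd z1 zp; rewrite gl => zl.
  have {}lj : (l < j)%N.
    rewrite ltn_neqAle lj andbT; apply/eqP => lj'.
    have := dvdn_gcdl (i' - i) (p ^ j); rewrite gl lj' => /dvdn_leq.
    by rewrite subn_gt0 => /(_ lt); lia.
  apply: nwj; split; first exact: leq_ltn_trans lj.
  by rewrite -(subnKC (_ : l <= j.-1)%N) ?expnD ?expgnA ?zl ?expg1n //; lia.
set r := (w ^+ _)%g in wr *.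
pose L := undup [seq restrict E (chain g r) | g <- B].
exists L => [|g gB]; last first.
  by apply: memv_span; rewrite mem_undup; apply/mapP; exists g.
have /choice[h hP] : forall v, exists g,
    v \in L -> g \in B /\ restrict E (chain g r) = v.
  move=> v; have [|vL] := boolP (v \in L); last by exists 1%g.
  by rewrite mem_undup => /mapP[g gB ->]; exists g.
(* Each chain v in [L] yields p^j points of [B']. These are all distinct: by [chain_shift] the loop
   at such a point has chain v, so the point determines v, and then the exponent by [zinj]. *)
rewrite -(size_iota 0 (p ^ j)) -(size_allpairs (fun v i => h v * phi w ^+ i)%g).
apply: uniq_leq_size; last first.
  move=> _ /allpairsP[[v i] /= [vL +  ->]]; rewrite mem_iota => /= ij.
  by apply: BB'; [have [] := hP v vL|].
apply: allpairs_uniq; rewrite ?undup_uniq ?iota_uniq //.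
move=> [v i] [v' i'] /allpairsP[[a b] /= [aL + [-> ->]]].
rewrite mem_iota => /= bj /allpairsP[[a' b'] /= [a'L + [-> ->]]].
rewrite mem_iota => /= b'j hab.
have aa' : a = a'.
  have [_ <-] := hP a aL; have [_ <-] := hP a' a'L.
  apply/ffunP => e; rewrite !ffunE.
  by rewrite -(chain_shift k b _ _ wr) hab chain_shift.
move: hab; rewrite aa' => /mulgI/zinj -> //.
Qed.

(** The finite sets [H] of base points and [S] of relators come from a basis of the cycle space,
    hence precede [A], [B] and the roots. This order lets [A] be chosen almost invariant with
    respect to [H] and the roots. *)
Lemma cycles_bound (p : nat) (R : set (free_group X)) (F F' : {fset G}) :
    p \in [pchar k] ->
    (forall g, exists w, phi w = g) ->
    (forall w, phi w = 1%g <-> normal_closure R w) ->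
    (F `<=` F')%fset ->
    (forall g x, g \in F -> (g * phi (free_gen x))%g \in F') ->
  exists (H : {fset G}) (S : {fset free_group X}),
  (forall r, r \in S -> R r) /\
  forall (w : free_group X -> free_group X) (j : free_group X -> nat)
      (A B : {fset G}),
    (forall r, r \in S -> w r ^+ (p ^ j r)%N = r)%g ->
    (forall g h r i, g \in A -> h \in H -> r \in S -> (i < p ^ j r)%N ->
       (g * h * phi (w r) ^+ i)%g \in B) ->
  exists2 L : free_group X -> nat,
    (forall r, r \in S -> (L r * p ^ j r <= #|` B|)%N) &
    (#|` A| * \dim (cycles F F') <= #|` F| * \sum_(r <- S) L r)%N.
Proof.
move=> pk phi_surj phi_ker FF' FgF'; set U := cycles F F'.
have UR u : u \in U -> relator_span phi R (extend u).
  move=> uU; apply: cycle_relator_span FF' FgF' _ _ => // [g x|h hF'].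
    exact: extend_out.
  move: uU; rewrite memv_ker lfunE /= => /eqP u0.
  have := congr1 (fun v : {ffun F' -> k^o} => v [` hF']%fset) u0.
  by rewrite !ffunE.
have /choice[s sP] : forall u, exists s : seq (k * (G * free_group X)),
    u \in U -> (forall t, t \in s -> R t.2.2) /\
      forall e, extend u e = \sum_(t <- s) t.1 * chain t.2.1 t.2.2 e.
  move=> u; have [/UR[s sR sE]|uU] := boolP (u \in U); last by exists [::].
  by exists s.
pose T := flatten [seq s u | u <- vbasis U].
have sT u t : u \in vbasis U -> t \in s u -> t \in T.
  by move=> uU tu; apply/flattenP; exists (s u) => //; apply: map_f.
pose H := [fset t.2.1 | t in T]%fset; pose S := [fset t.2.2 | t in T]%fset.
exists H, S.
have SR r : r \in S -> R r.
  case/imfsetP => t /flattenP[_ /mapP[u uU ->] tu] ->.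
  by have [sR _] := sP u (vbasis_mem uU); exact: sR.
split=> // w j A B wj AB; pose E := fset_mul A F.
have /choice[L LP] : forall r, exists L : seq (finite_chains E), r \in S ->
    (size L * p ^ j r <= #|` B|)%N /\
    forall g, g \in fset_mul A H -> restrict E (chain g r) \in <<L>>%VS.
  move=> r; have [rS|rS] := boolP (r \in S); last by exists [::].
  have [||L] := @relator_chains_span p (j r) (w r) (fset_mul A H) B E pk.
  - by rewrite wj //; apply/phi_ker; apply: sub_gen_smallest; exact: SR.
  - by move=> _ i /fset_mulP[g [h [gA hH ->]]] ij; exact: AB.
  - by rewrite wj //; exists L.
exists (fun r => size (L r)) => [r rS|]; first by have [] := LP r rS.
pose V := <<flatten [seq L r | r <- S]>>%VS.
have dimV : (\dim V <= \sum_(r <- S) size (L r))%N.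
  by apply: leq_trans (dim_span _) _; rewrite size_flatten sumnE !big_map.
have LV r : r \in S -> (<<L r>> <= V)%VS.
  move=> rS; apply: sub_span => v vL; apply/flattenP.
  by exists (L r) => //; apply: map_f.
pose tau g := linfun (@translate F E g).
have tauV g : g \in (A : seq G) -> (tau g @: U <= V)%VS.
  move=> gA; rewrite -(span_basis (vbasisP U)) limg_span; apply/span_subvP.
  move=> _ /mapP[u uU ->]; have [_ uE] := sP u (vbasis_mem uU).
  have -> : tau g u =
      \sum_(t <- s u) t.1 *: restrict E (chain (g * t.2.1)%g t.2.2).
    rewrite lfunE; apply/ffunP => e; rewrite /= ffunE uE sum_ffunE.
    apply: eq_bigr => t _; rewrite !ffunE -(chain_translate k phi g).
    by rewrite mulVKg.
  rewrite big_seq; apply: memv_suml => t tu; apply: memvZ.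
  have tS : t.2.2 \in S by apply: in_imfset; apply: sT tu.
  have [_ spanL] := LP _ tS.
  apply: (subvP (LV _ tS)); apply: spanL; apply: mem_fset_mul => //.
  by apply: in_imfset; apply: sT tu.
have dim_tau g : g \in (A : seq G) -> \dim (tau g @: U) = \dim U.
  move=> gA; apply: limg_dim_eq; rewrite lker_translate ?capv0 // => f fF.
  exact: mem_fset_mul.
apply: leq_trans (leq_mul (leqnn _) dimV).
(* The functionals are the coordinates of chains on [E]; each is nonzero on at most |F|
   translates. *)
have := @sum_dim_le k _ _ A #|` F|
  [seq linfun (@coefficient E e) | e <- enum {: E * X}] (fun g => tau g @: U)%VS V.
rewrite big_seq (eq_bigr _ dim_tau) -big_seq big_const_seq count_predT iter_addn_0.
rewrite mulnC; apply => // [v _ v0|f /mapP[e _ ->]]; last exact: count_translate.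
apply/ffunP => e; rewrite [RHS]ffunE.
have /v0 : linfun (@coefficient E e) \in
    [seq linfun (@coefficient E e) | e <- enum {: E * X}].
  by apply: map_f; rewrite mem_enum.
by rewrite lfunE.
Qed.

End FiniteChains.

(** * Approximating the weight of a relator by an actual root *)

Section RootExponents.
Local Open Scope ring_scope.
Variable K : realType.

Lemma p_weight_ge0 (p : nat) (X : choiceType) (r : free_group X) :
  0 <= p_weight K p r.
Proof. by rewrite /p_weight; case: nu => // j; rewrite invr_ge0 exprn_ge0. Qed.

(* Covers relators whose set of root exponents is unbounded, such as r = 1:
   these have weight 0. *)
Lemma root_exponent_weight (p : nat) (X : choiceType) (r : free_group X)
    (e : K) : prime p -> 0 < e ->
  exists j (w : free_group X), (w ^+ (p ^ j)%N)%g = r /\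
    (p ^ j)%:R^-1 <= p_weight K p r + e.
Proof.
move=> p_pr e0.
have weight_ge0 := p_weight_ge0 p r.
have root0 : root_exponents p r 0%N by exists r.
have [[N rootN]|unbounded] :=
    pselect (exists N, forall j, root_exponents p r j -> (j <= N)%N).
  have exP : exists j, `[< root_exponents p r j >].
    by exists 0%N; apply/asboolP.
  have ubP j : `[< root_exponents p r j >] -> (j <= N)%N.
    by move=> /asboolP; exact: rootN.
  have [m /asboolP rm mmax] := ex_maxnP exP ubP.
  have [j [[w wr] _] nuE] : exists2 j, root_exponents p r j /\
      (forall i, root_exponents p r i -> (i <= j)%N) & Some j = nu p r.
    apply: (@xgetPex _ None [set Some k | k in [set k | root_exponents p r k /\
             forall j, root_exponents p r j -> (j <= k)%N]]%classic).
    exists (Some m), m => //; split=> // i ri.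
    by apply: mmax; apply/asboolP.
  exists j, w; split=> //.
  by rewrite /p_weight -nuE natrX lerDl ltW.
(* A root exponent j > N suffices, because p^j > j > N > 1/e. *)
pose N := Num.bound e^-1.
have [j [rj Nj]] : exists j, root_exponents p r j /\ (N < j)%N.
  apply: contrapT => nex; apply: unbounded; exists N => j rj.
  by rewrite leqNgt; apply/negP => Nj; apply: nex; exists j.
have [w wr] := rj; exists j, w; split=> //.
apply: (@le_trans _ _ e); last by rewrite lerDr.
rewrite -[leRHS]invrK lef_pV2 ?posrE ?invr_gt0 ?ltr0n ?expn_gt0 ?prime_gt0 //.
apply: (@le_trans _ _ N%:R).
  by apply: ltW; rewrite archi_boundP // invr_ge0 ltW.
rewrite ler_nat; apply: ltnW; apply: (ltn_trans Nj).
by rewrite ltn_expl ?prime_gt1.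
Qed.

End RootExponents.

(** * The deficiency bound for amenable groups and the conclusion *)

Section NonAmenable.
Local Open Scope ring_scope.

Lemma sum_weight_le (K : realType) (p : nat) (X : finType)
    (R : set (free_group X)) (S : {fset free_group X}) (s : K) :
  (\esum_(r in R) (p_weight K p r)%:E)%E = s%:E ->
  (forall r, r \in S -> R r) -> \sum_(r <- S) p_weight K p r <= s.
Proof.
move=> sE SR; rewrite -lee_fin -sE; apply: esum_ge.
exists [set` S]%classic; first by split => // r; exact: SR.
by rewrite -fsbig_seq ?fset_uniq // sumEFin.
Qed.

(** Two Følner sets are used: [F] for the generators, then [A] for the finite set [T] obtained from
    the cycles on [F]. As e tends to 0 the bound becomes |X| - 1 <= s. *)
Lemma amenable_deficiency_le (K : realType) (G : groupType) (p : nat)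
    (X : finType) (R : set (free_group X)) (s e : K) :
    amenable K G -> prime p -> has_presentation R G ->
    (\esum_(r in R) (p_weight K p r)%:E)%E = s%:E -> 0 < e ->
  #|X|%:R - (1 + e) <= (1 + e) * (s + e).
Proof.
move=> amG p_pr [phi [phi_surj phi_ker]] sE e0.
pose T0 := (1%g |` [fset phi (free_gen x) | x : X])%fset.
have [F F0 FT0] := folner T0 amG e0; set F' := fset_mul F T0 in FT0.
have FF' : (F `<=` F')%fset.
  by apply/fsubsetP => g gF; rewrite -[g]mulg1 mem_fset_mul // fset1U1.
have FgF' g x : g \in F -> (g * phi (free_gen x))%g \in F'.
  move=> gF; apply: mem_fset_mul => //; apply/fset1UP; right.
  by apply/imfsetP; exists x.
have [H [S [SR bound]]] :=
  cycles_bound (pchar_Fp p_pr) phi_surj phi_ker FF' FgF'.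
have := dim_cycles 'F_p phi F F'; set d := \dim _ => dimU.
(* The error allowed per relator, so that the total over [S] is at most [e]; the added 1 covers
   empty [S]. *)
pose eta := e / (#|` S|%:R + 1).
have Sp : 0 < #|` S|%:R + 1 :> K by rewrite ltr_wpDl.
have eta0 : 0 < eta by rewrite divr_gt0.
have /choice[j /choice[w wP]] := fun r : free_group X =>
  root_exponent_weight r p_pr eta0.
pose powers r := [fset phi (w r) ^+ i | i in iota 0 (p ^ j r)]%g%fset.
pose T := (\bigcup_(r <- S) fset_mul H (powers r))%fset.
have [A A0 AT] := folner T amG e0.
have [|g h r i gA hH rS ij|L LS dimL] := bound w j A (fset_mul A T).
- by move=> r _; have [] := wP r.
- rewrite -mulgA; apply: mem_fset_mul => //.
  apply/bigfcupP; exists r; rewrite ?rS //; apply: mem_fset_mul => //.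
  by apply/imfsetP; exists i; rewrite //= mem_iota.
have F_gt0 : 0 < #|` F|%:R :> K by rewrite ltr0n cardfs_gt0.
have A_gt0 : 0 < #|` A|%:R :> K by rewrite ltr0n cardfs_gt0.
have sumL : (\sum_(r <- S) L r)%:R <= (1 + e) * #|` A|%:R * (s + e) :> K.
  apply: (@le_trans _ _ (\sum_(r <- S) #|` fset_mul A T|%:R *
                         (p_weight K p r + eta))).
    rewrite natr_sum big_seq [leRHS]big_seq; apply: ler_sum => r rS.
    have [_ wr] := wP r.
    apply: (@le_trans _ _ (#|` fset_mul A T|%:R * (p ^ j r)%:R^-1)).
      rewrite ler_pdivlMr ?ltr0n ?expn_gt0 ?prime_gt0 //.
      by rewrite -natrM ler_nat LS.
    by rewrite ler_wpM2l.
  rewrite -mulr_sumr big_split /=.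
  have eta_le : \sum_(r <- S) eta <= e.
    rewrite big_const_seq count_predT iter_addr_0 -mulr_natr /eta.
    by rewrite mulrAC ler_pdivrMr // ler_pM2l // lerDl.
  have sum0 : 0 <= \sum_(r <- S) p_weight K p r + \sum_(r <- S) eta.
    rewrite addr_ge0 ?sumr_ge0 // => r _; [exact: p_weight_ge0|exact: ltW].
  apply: ler_pM => //; apply: lerD => //.
  exact: sum_weight_le sE SR.
have dF : #|` F|%:R * #|X|%:R <= d%:R + (1 + e) * #|` F|%:R :> K.
  by apply: le_trans (lerD (lexx _) FT0); rewrite -natrM -natrD ler_nat.
have dA : #|` A|%:R * d%:R <= #|` F|%:R * ((1 + e) * #|` A|%:R * (s + e)) :> K.
  by apply: le_trans (ler_wpM2l _ sumL); rewrite -?natrM ?ler_nat.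
have dA' : d%:R <= #|` F|%:R * ((1 + e) * (s + e)) :> K.
  rewrite -(ler_pM2l A_gt0); apply: le_trans dA _; lra.
rewrite -(ler_pM2l F_gt0); lra.
Qed.

End NonAmenable.

Theorem proposition6p2 (K : realType) (G : groupType) :
  Puchta_group K G -> ~ amenable K G.
Proof.
move=> [p [X [R [p_pr presG defG]]]] amG.
have s0 : (0 <= (\esum_(r in R) (p_weight K p r)%:E)%R)%E.
  by apply: esum_ge0 => r _; rewrite lee_fin p_weight_ge0.
move: defG; rewrite /p_deficiency.
(* A divergent sum would make the deficiency -oo, so the sum is a real [s]. *)
case sE: (esum _ _) s0 => [s| |] //; rewrite lee_fin lte_fin => s0 def.
pose d := (#|X|%:R - s - 1)%R.
have d0 : (0 < d)%R by rewrite /d; lra.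
have sd : (0 < s + 4 + d)%R by lra.
(* With |X| = d + s + 1 the bound reads d <= e (s + 2 + e). As e <= 1, the right side is at most e
   (s + 3), which is less than e (s + 4 + d) = d. *)
pose e := (d / (s + 4 + d))%R.
have e0 : (0 < e)%R by rewrite divr_gt0.
have eE : (e * (s + 4 + d) = d)%R by rewrite divfK ?gt_eqF.
have e1 : (e <= 1)%R by rewrite ler_pdivrMr // mul1r; lra.
have := amenable_deficiency_le amG p_pr presG sE e0.
have -> : (#|X|%:R = d + s + 1 :> K)%R by rewrite /d; lra.
nra.
Qed.
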